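(* Let $E$ be a finite-dimensional Euclidean space, let $A=\{a^1,\dots,a^m\}\subset E$ be a nonempty finite set with convex hull $A_c=\mathrm{co}\{A\}$ such that $\mathbf 0\notin A_c$, let $b\in E$, and let $K(A)=\bigcup_{\lambda\ge 0}\lambda A_c$ be the finitely generated convex cone with generators $A$. Put $d_A=\min_{x\in A_c}\|x\|$ and $\rho_{\min}=\|b\|/d_A$. For $\rho>0$ let $b^K$ and $b^{\mathrm{co}}$ be the orthogonal projections of $b$ onto $K(A)$ and onto $\mathrm{co}\{\mathbf 0,\rho A_c\}$, respectively, and assume that $\|b^K-b\|>0$ and $\|b^{\mathrm{co}}-b\|>0$. If $\rho>\rho_{\min}$, then $b^K=b^{\mathrm{co}}$.
   Context: $E$ is a finite-dimensional real inner product space with norm $\|\cdot\|$ induced by the inner product; $\mathbf 0$ is its zero vector. For $\rho\in\mathbb R$ and $X\subset E$, $\rho X=\{\rho x: x\in X\}$. $\mathrm{co}\{\mathbf 0,\rho A_c\}$ denotes the convex hull of $\{\mathbf 0\}\cup\rho A_c$. The orthogonal projection of $b$ onto a nonempty closed convex set $X\subset E$ is the unique point of $X$ minimizing $\|x-b\|$ over $x\in X$. *)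

(* Defs.v *)
From HB Require Import structures.
From mathcomp Require Import all_boot all_order all_algebra.
From mathcomp Require Import sesquilinear.
From mathcomp Require Import boolp classical_sets cardinality reals convex.

Set Implicit Arguments.
Unset Strict Implicit.
Unset Printing Implicit Defensive.
Import Order.TTheory GRing.Theory Num.Theory.
Local Open Scope ring_scope.
Local Open Scope classical_set_scope.

Definition dnorm (R : realType) (E : vectType R) (dot : {dot E for idfun})
  (x : E) : R := Num.sqrt (dot x x).

Definition conv_hull (R : realType) (E : vectType R) (X : set E) : set E :=
  smallest (@convex_set R E) X.

Definition dilate (R : realType) (E : vectType R) (l : R) (X : set E) : set E :=
  [set l *: x | x in X].

Definition gen_cone (R : realType) (E : vectType R) (A : set E) : set E :=
  \bigcup_(l in [set l : R | 0 <= l]) dilate l (conv_hull A).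

(* 0 is a default value, returned only when S has no minimum. *)
Definition set_min (R : realType) (S : set R) : R :=
  xget 0 [set m | S m /\ lbound S m].

(* On a nonempty closed convex set, and in particular on the hulls and cones
   of finite sets, the minimizer exists and is unique; the default value 0 is
   returned only when X contains no minimizer. *)
Definition orth_proj (R : realType) (E : vectType R) (dot : {dot E for idfun})
    (X : set E) (b : E) : E :=
  xget 0 [set p | X p /\ forall x, X x -> dnorm dot (p - b) <= dnorm dot (x - b)].

(* Main.v *)
(** Let [p] be the nearest point to [b] in the truncated cone
    [co {0, rho A_c} = {s x : 0 <= s <= rho, x \in A_c}]. Since that set is
    stable under scaling towards 0, [|p| <= |b| < rho d_A], so [p = s x] with
    [s < rho] strictly. Hence every segment from [p] to a point of [K(A)] starts
    inside the truncated cone, and convexity of the squared distance to [b]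
    makes [p] a nearest point in the whole cone. Nearest points in convex sets
    being unique, [p] is both projections. *)
Require Import Defs.
From mathcomp Require Import all_boot all_order all_algebra.
From mathcomp Require Import sesquilinear.
From mathcomp Require Import boolp classical_sets cardinality reals convex.
From mathcomp Require Import interval_inference topology normedtype derive ring lra.
Import Order.TTheory GRing.Theory Num.Theory.
Import numFieldNormedType.Exports.
Local Open Scope ring_scope.
Local Open Scope classical_set_scope.

Set Implicit Arguments.
Unset Strict Implicit.

(** * Convex hulls, dilations and cones *)

Section Convexity.
Context {R : realType} {E : vectType R}.
Implicit Types (X : set E) (a x y : E).

Lemma convex_setP X : @convex_set R E X <->
  forall x y (t : R), 0 <= t <= 1 -> X x -> X y -> X (t *: x + (1 - t) *: y).
Proof.
split=> [cX x y t /andP[t0 t1] Xx Xy|cX x y t /set_mem Xx /set_mem Xy].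
  have := cX x y (Itv01 t0 t1) (mem_set Xx) (mem_set Xy).
  by move/set_mem.
by apply/mem_set/cX => //; rewrite ge0 le1.
Qed.

Lemma convex_conv_hull X : @convex_set R E (conv_hull X).
Proof.
apply/convex_setP => x y t t01 hx hy C [cC XC].
by have /convex_setP := cC; apply => //; [apply: hx|apply: hy].
Qed.

Lemma convex_dilate (r : R) X :
  @convex_set R E X -> @convex_set R E (dilate r X).
Proof.
move=> /convex_setP cX; apply/convex_setP => p q t t01 [x Xx <-] [y Xy <-].
exists (t *: x + (1 - t) *: y); first exact: cX.
by rewrite scalerDr !scalerA ![r * _]mulrC.
Qed.

(** Dividing by [s + r] leaves a convex combination of [x] and [y]; if [s + r = 0], both weights
    vanish and any point serves. *)
Lemma convex_combine X (s r : R) x y :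
  @convex_set R E X -> 0 <= s -> 0 <= r -> X x -> X y ->
  exists2 z, X z & s *: x + r *: y = (s + r) *: z.
Proof.
move=> /convex_setP cX s0 r0 Xx Xy.
have [sr0|sr_neq0] := eqVneq (s + r) 0.
  have s_eq0 : s = 0 by lra.
  have r_eq0 : r = 0 by lra.
  by exists x => //; rewrite s_eq0 r_eq0 addr0 !scale0r addr0.
have sr_gt0 : 0 < s + r by rewrite lt0r sr_neq0 addr_ge0.
exists ((s / (s + r)) *: x + (1 - s / (s + r)) *: y).
  by apply: cX => //; rewrite divr_ge0 ?(ltW sr_gt0)//= ler_pdivrMr//; lra.
rewrite scalerDr !scalerA; congr (_ *: _ + _ *: _); field => //.
Qed.

(** For nonempty convex [X] this is the convex hull of [a] and [X], with the weight [s] kept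
    explicit so that it can serve as a parameter. *)
Definition join a X : set E :=
  [set q | exists s x, [/\ 0 <= s <= 1, X x & q = (1 - s) *: a + s *: x]].

Lemma convex_join a X : @convex_set R E X -> @convex_set R E (join a X).
Proof.
move=> cX; apply/convex_setP => p q t /andP[t0 t1].
move=> [s [x [/andP[s0 s1] Xx ->]]] [r [y [/andP[r0 r1] Xy ->]]].
have ts0 : 0 <= t * s by rewrite mulr_ge0.
have tr0 : 0 <= (1 - t) * r by rewrite mulr_ge0// subr_ge0.
have [z Xz zE] := convex_combine cX ts0 tr0 Xx Xy.
exists (t * s + (1 - t) * r), z; split => //.
  by apply/andP; split; nra.
rewrite -zE !scalerDr !scalerA addrACA -scalerDl; congr (_ *: _ + _); ring.
Qed.

(** The join is convex and contains all generators, and each of its points is a convex combination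
    inside the hull. Generators can thus be added one at a time. *)
Lemma conv_hull_setU1 a X : X !=set0 ->
  conv_hull ([set a] `|` X) = join a (conv_hull X).
Proof.
move=> [x0 Xx0]; apply/seteqP; split.
  apply: smallest_sub; first exact/convex_join/convex_conv_hull.
  move=> x [/= ->|Xx].
    exists 0, x0; split; rewrite ?lexx ?ler01//; first exact: sub_gen_smallest.
    by rewrite subr0 scale1r scale0r addr0.
  exists 1, x; split; rewrite ?lexx ?ler01//; first exact: sub_gen_smallest.
  by rewrite subrr scale1r scale0r add0r.
move=> _ [s [x [/andP[s0 s1] hx ->]]].
have /convex_setP cC := convex_conv_hull (X := [set a] `|` X).
rewrite addrC; apply: cC; first by rewrite s0.
  by apply: sub_smallest2r hx; [exact: convex_conv_hull|move=> y Xy; right].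
by apply: sub_gen_smallest; left.
Qed.

Lemma conv_hull_set1 a : conv_hull [set a] = [set a].
Proof.
apply: smallest_id; apply/convex_setP => x y t _ -> ->.
by rewrite -scalerDl subrKC scale1r.
Qed.

Lemma conv_hull0_dilate (r : R) X : 0 <= r -> @convex_set R E X -> X !=set0 ->
  conv_hull ([set 0] `|` dilate r X) =
  [set q | exists s x, [/\ 0 <= s <= r, X x & q = s *: x]].
Proof.
move=> r0 cX [x0 Xx0]; rewrite conv_hull_setU1; last by exists (r *: x0), x0.
rewrite /conv_hull smallest_id; last exact: convex_dilate.
apply/seteqP; split=> [_ [s [_ [/andP[s0 s1] [x Xx <-] ->]]]|_ [s [x [/andP[s0 sr] Xx ->]]]].
  exists (s * r), x; split => //; first by apply/andP; split; nra.
  by rewrite scaler0 add0r scalerA.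
(* If [r = 0], the quotient is 0 by convention and the bounds force [s = 0], so the witness remains
   valid. *)
exists (s / r), (r *: x); split; [|by exists x|].
  have [->|rn0] := eqVneq r 0; first by rewrite invr0 mulr0 lexx ler01.
  by rewrite divr_ge0//= ler_pdivrMr ?lt0r ?rn0// mul1r.
rewrite scaler0 add0r scalerA; have [rE|rn0] := eqVneq r 0.
  have -> : s = 0 by lra.
  by rewrite mul0r mul0r scale0r.
by rewrite divfK.
Qed.

Lemma convex_gen_cone X : @convex_set R E (gen_cone X).
Proof.
apply/convex_setP => p q t /andP[t0 t1] [s /= s0 [x hx <-]] [r /= r0 [y hy <-]].
have ts0 : 0 <= t * s by rewrite mulr_ge0.
have tr0 : 0 <= (1 - t) * r by rewrite mulr_ge0// subr_ge0.
have [z hz zE] := convex_combine (convex_conv_hull (X := X)) ts0 tr0 hx hy.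
exists (t * s + (1 - t) * r); first exact: addr_ge0.
by exists z => //; rewrite -zE !scalerA.
Qed.

End Convexity.

(** * Inner products and nearest points *)

Section Projection.
Context {R : realType} {E : vectType R} (dot : {dot E for idfun}).
Implicit Types (X : set E) (a b p q u v x y : E).

Lemma dotC u v : dot u v = dot v u.
Proof. by rewrite hermC expr0 mul1r. Qed.

Lemma dotDl u v x : dot (u + v) x = dot u x + dot v x.
Proof. exact: linearDl. Qed.

Lemma dotZl (r : R) u x : dot (r *: u) x = r * dot u x.
Proof. exact: linearZl_LR. Qed.

Lemma dotDr u v x : dot x (u + v) = dot x u + dot x v.
Proof. by rewrite dotC dotDl !(dotC x). Qed.

Lemma dotZr (r : R) u x : dot x (r *: u) = r * dot x u.
Proof. by rewrite dotC dotZl dotC. Qed.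

Lemma dotNl u x : dot (- u) x = - dot u x.
Proof. by rewrite -scaleN1r dotZl mulN1r. Qed.

Lemma dotNr u x : dot x (- u) = - dot x u.
Proof. by rewrite dotC dotNl dotC. Qed.

Definition dotE := (dotDl, dotDr, dotZl, dotZr, dotNl, dotNr).

Lemma dot_gt0 u : u != 0 -> 0 < dot u u.
Proof. exact: neq0_dnorm_gt0. Qed.

Lemma dot0l u : dot 0 u = 0.
Proof. by rewrite -(scale0r 0) dotZl mul0r. Qed.

Lemma dot_ge0 u : 0 <= dot u u.
Proof. by have [->|/dot_gt0/ltW//] := eqVneq u 0; rewrite dot0l. Qed.

Lemma ler_dnorm u v : (dnorm dot u <= dnorm dot v) = (dot u u <= dot v v).
Proof. by rewrite ler_sqrt// dot_ge0. Qed.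

(** Squared distances have the same minimizers as [dnorm] and stay polynomial in the inner
    products. *)
Definition nearest X b : set E :=
  [set p | X p /\ forall x, X x -> dot (p - b) (p - b) <= dot (x - b) (x - b)].

Lemma orth_projE X b : orth_proj dot X b = xget 0 (nearest X b).
Proof.
congr xget; apply/funext => p; apply/propext.
by split=> -[Xp pmin]; split=> // x /pmin; rewrite ler_dnorm.
Qed.

(** At the midpoint the squared distance to [b] is the mean of the two values minus a quarter of
    [dot (p - q) (p - q)], so distinct nearest points would be beaten by their midpoint. *)
Lemma nearest_unique X b p q : @convex_set R E X ->
  nearest X b p -> nearest X b q -> p = q.
Proof.
move=> /convex_setP cX [Xp pmin] [Xq qmin].
apply/eqP; rewrite -subr_eq0; apply: contraT => /dot_gt0.
have half : 0 <= (2^-1 : R) <= 1 by apply/andP; split; lra.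
have := pmin _ (cX _ _ _ half Xp Xq); have := qmin _ Xp.
rewrite !dotE !(dotC b) (dotC q p); lra.
Qed.

Lemma orth_projP X b p : @convex_set R E X -> nearest X b p ->
  orth_proj dot X b = p.
Proof.
move=> cX pn; rewrite orth_projE; apply: (nearest_unique cX _ pn).
exact: (xgetI _ pn).
Qed.

(* [E] carries no topology: compactness is expressed through a parametrization
   along which the inner products are continuous. *)
Definition compact_image X := exists (T : topologicalType) (K : set T) (f : T -> E),
  [/\ compact K, X = f @` K, forall v, continuous (fun t => dot (f t) v)
    & continuous (fun t => dot (f t) (f t))].

(** The squared distance expands into the two kinds of functions assumed continuous, so the extreme
    value theorem applies on [K]. *)
Lemma compact_image_nearest X b : compact_image X -> X !=set0 ->
  nearest X b !=set0.
Proof.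
move=> [T [K [f [cK -> fl fq]]]] [_ [t0 Kt0 _]].
have gE : (fun t => dot (f t - b) (f t - b)) =
    (fun t => dot (f t) (f t) - 2 * dot (f t) b + dot b b).
  by apply/funext => t; rewrite !dotE !(dotC b); ring.
have gc : continuous (fun t => dot (f t - b) (f t - b)).
  rewrite gE => t; apply: cvgD; last exact: cvg_cst.
  apply: cvgB; first exact: fq.
  by apply: cvgM; [exact: cvg_cst|exact: fl].
have [|t tK tmin] := compact_EVT_min (ex_intro _ t0 Kt0) cK (f := fun t => dot (f t - b) (f t - b)).
  exact: continuous_subspaceT.
exists (f t); split; first by exists t => //; exact: set_mem.
by move=> _ [u Ku <-]; apply: tmin; exact: mem_set.
Qed.

Lemma compact_image_set1 a : compact_image [set a].
Proof.
exists R, [set 0], (fun=> a); split.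
- exact: compact_set1.
- by apply/seteqP; split => [x ->|x [_ _ <-]//]; exists 0.
- by move=> v t; exact: cvg_cst.
- by move=> t; exact: cvg_cst.
Qed.

Lemma compact_image_join a X : compact_image X -> compact_image (join a X).
Proof.
move=> [T [K [f [cK -> fl fq]]]].
(* The weight in the join becomes an additional compact parameter. *)
exists (R * T)%type, (`[0, 1]%classic `*` K),
  (fun z => (1 - z.1) *: a + z.1 *: f z.2).
have c1 : continuous (fun z : R * T => z.1) by move=> z; exact: cvg_fst.
have c2 v : continuous (fun z : R * T => dot (f z.2) v).
  move=> z; apply: (@continuous_comp _ _ _ snd (fun t => dot (f t) v)).
    exact: cvg_snd.
  exact: fl.
have c3 : continuous (fun z : R * T => dot (f z.2) (f z.2)).
  move=> z; apply: (@continuous_comp _ _ _ snd (fun t => dot (f t) (f t))).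
    exact: cvg_snd.
  exact: fq.
have c4 : continuous (fun z : R * T => 1 - z.1).
  by move=> z; apply: cvgB; [exact: cvg_cst|exact: c1].
split.
- by apply: compact_setX => //; exact: segment_compact.
- apply/seteqP; split=> [_ [s [_ [s01 [t Kt <-] ->]]]|_ [[s t] [/= s01 Kt] <-]].
    by exists (s, t) => //; split => //=; rewrite in_itv.
  by exists s, (f t); split; [rewrite in_itv in s01|exists t|].
- move=> v; under eq_fun do rewrite !dotE.
  move=> z; apply: cvgD.
    by apply: cvgM; [exact: c4|exact: cvg_cst].
  by apply: cvgM; [exact: c1|exact: c2].
- have -> : (fun z : R * T => dot ((1 - z.1) *: a + z.1 *: f z.2)
                                ((1 - z.1) *: a + z.1 *: f z.2)) =
      (fun z => (1 - z.1) * (1 - z.1) * dot a a +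
        (2 * (z.1 * (1 - z.1)) * dot (f z.2) a + z.1 * z.1 * dot (f z.2) (f z.2))).
    by apply/funext => z; rewrite !dotE (dotC a); ring.
  move=> z; apply: cvgD; first by
    apply: cvgM; [apply: cvgM; exact: c4|exact: cvg_cst].
  apply: cvgD; last by
    apply: cvgM; [apply: cvgM; exact: c1|exact: c3].
  apply: cvgM; last exact: c2.
  apply: cvgM; first exact: cvg_cst.
  by apply: cvgM; [exact: c1|exact: c4].
Qed.

Lemma compact_image_dilate (r : R) X : compact_image X -> compact_image (dilate r X).
Proof.
move=> [T [K [f [cK -> fl fq]]]]; exists T, K, (fun t => r *: f t).
split=> //; first by rewrite /dilate image_comp.
- move=> v; under eq_fun do rewrite dotZl.
  by move=> t; apply: cvgM; [exact: cvg_cst|exact: fl].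
- under eq_fun do rewrite dotZl dotZr.
  move=> t; apply: cvgM; first exact: cvg_cst.
  by apply: cvgM; [exact: cvg_cst|exact: fq].
Qed.

Lemma compact_image_conv_hull (A : set E) : finite_set A -> A !=set0 ->
  compact_image (conv_hull A).
Proof.
move=> /finite_seqP[s ->]; elim: s => [[x]|a s IHs _]; first by rewrite /= in_nil.
have -> : [set` a :: s] = [set a] `|` [set` s].
  apply/seteqP; split => x /=; rewrite in_cons.
    by move=> /orP[/eqP|]; [left|right].
  by move=> [->|->]; rewrite ?eqxx ?orbT.
(* An empty tail is treated apart: the hull is then the single point [a]. *)
have [s0|/nonemptyPn/= -> ] := pselect ([set` s] !=set0); last first.
  by rewrite setU0 conv_hull_set1; exact: compact_image_set1.
by rewrite conv_hull_setU1//; exact/compact_image_join/IHs.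
Qed.

(* If [|p| > |b|], moving from [p] slightly towards 0 would get closer to [b]. *)
Lemma nearest_le X b p : (forall x (t : R), 0 <= t <= 1 -> X x -> X (t *: x)) ->
  nearest X b p -> dot p p <= dot b b.
Proof.
move=> sX [Xp pmin]; rewrite leNgt; apply/negP => bp.
have pp : 0 < dot p p := le_lt_trans (dot_ge0 b) bp.
pose c := dot b b / dot p p.
have cE : c * dot p p = dot b b by rewrite divfK ?gt_eqF.
have c0 : 0 <= c by rewrite divr_ge0 ?dot_ge0 ?ltW.
have c1 : c < 1 by rewrite ltr_pdivrMr// mul1r.
(* Minimality against [t *: p] with [t < 1] gives [(1 + t) * dot p p <= 2 * dot p b], and [h2]
   bounds the right side by [(1 + c) * dot p p]. Hence [t <= c], which fails for the midpoint of [c]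
   and 1. *)
have t01 : 0 <= (1 + c) / 2 <= 1 by apply/andP; split; lra.
have h1 := pmin _ (sX _ _ t01 Xp).
have h2 := dot_ge0 (p - b).
move: h1 h2; rewrite !dotE !(dotC b) -cE.
set P := dot p p in pp *; set B := dot p b.
move=> h1 h2.
have := mulr_gt0 pp (_ : 0 < (1 - c) ^+ 2).
rewrite exprn_gt0 ?subr_gt0// => /(_ isT) h3.
nra.
Qed.

(** Since [x0] attains the minimum, [set_min] does not fall back on its default, and a minimum is
    unique by antisymmetry. *)
Lemma set_min_dnorm X x0 : nearest X 0 x0 ->
  set_min [set dnorm dot x | x in X] = dnorm dot x0.
Proof.
move=> [Xx0 x0min]; set S := [set dnorm dot x | x in X].
have mS : S (dnorm dot x0) /\ lbound S (dnorm dot x0).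
  split; first by exists x0.
  by move=> _ [x Xx <-]; rewrite ler_dnorm; have := x0min _ Xx; rewrite !subr0.
have [Sm lm] : S (set_min S) /\ lbound S (set_min S).
  exact: (xgetI (P := [set m | S m /\ lbound S m]) 0 mS).
by apply/eqP; rewrite eq_le (lm _ mS.1) (mS.2 _ Sm).
Qed.

(* As [s < rho], every segment from [s *: x] into the cone starts inside the
   truncated cone, and the squared distance to [b] is convex along it. *)
Lemma nearest_gen_cone (A : set E) b (rho s : R) x :
  0 <= s -> s < rho -> conv_hull A x ->
  nearest [set q | exists r y, [/\ 0 <= r <= rho, conv_hull A y & q = r *: y]]
    b (s *: x) ->
  nearest (gen_cone A) b (s *: x).
Proof.
move=> s0 s_lt hx [_ pmin]; split; first by exists s => //; exists x.
move=> _ [r /= r0 [y hy <-]].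
have d0 : 0 < rho - s + r by lra.
(* With this choice the total weight [(1 - e) * s + e * r] equals [(1 - e) * rho], hence is at most
   [rho]. *)
pose e := (rho - s) / (rho - s + r).
have e0 : 0 < e by rewrite divr_gt0// subr_gt0.
have e1 : e <= 1 by rewrite ler_pdivrMr// mul1r; lra.
have er : e * (rho - s + r) = rho - s by rewrite divfK ?gt_eqF.
clearbody e.
have es0 : 0 <= (1 - e) * s by rewrite mulr_ge0// subr_ge0.
have er0 : 0 <= e * r by rewrite mulr_ge0// ltW.
have [z hz zE] := convex_combine (convex_conv_hull (X := A)) es0 er0 hx hy.
have /pmin : exists r' y', [/\ 0 <= r' <= rho, conv_hull A y' &
    ((1 - e) * s) *: x + (e * r) *: y = r' *: y'].
  exists ((1 - e) * s + e * r), z; split => //.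
  by apply/andP; split; nra.
rewrite -!scalerA; move: (s *: x) (r *: y) => p q le_pq.
have convE : dot ((1 - e) *: p + e *: q - b) ((1 - e) *: p + e *: q - b) =
    (1 - e) * dot (p - b) (p - b) + e * dot (q - b) (q - b)
    - e * (1 - e) * dot (p - q) (p - q).
  by rewrite !dotE !(dotC b) (dotC q p); ring.
(* Dropping this term leaves the chord inequality, in which the positive factor [e] cancels. *)
have eq_ge0 : 0 <= e * (1 - e) * dot (p - q) (p - q).
  by rewrite mulr_ge0 ?dot_ge0// mulr_ge0 ?(ltW e0)// subr_ge0.
by rewrite -(ler_pM2l e0); move: le_pq; rewrite convE; lra.
Qed.

End Projection.

(** * Coincidence of the two projections *)

Unset Implicit Arguments.

Theorem mainTheorem2 (R : realType) (E : vectType R) (dot : {dot E for idfun})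
    (A : set E) (b : E) (rho : R) :
  finite_set A -> A !=set0 ->
  let Ac := conv_hull A in
  ~ Ac 0 ->
  let dA := set_min [set dnorm dot x | x in Ac] in
  let rho_min := dnorm dot b / dA in
  0 < rho ->
  let bK := orth_proj dot (gen_cone A) b in
  let bco := orth_proj dot (conv_hull ([set 0] `|` dilate rho Ac)) b in
  0 < dnorm dot (bK - b) ->
  0 < dnorm dot (bco - b) ->
  rho_min < rho ->
  bK = bco.
Proof.
move=> finA [a Aa] Ac Ac0 dA rho_min rho0 bK bco _ _.
have Aca : Ac a by exact: sub_gen_smallest.
have cAc : @convex_set R E Ac by exact: convex_conv_hull.
have cptAc : compact_image dot Ac.
  by apply: compact_image_conv_hull => //; exists a.
have [x0 x0n] : nearest dot Ac 0 !=set0.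
  by apply: compact_image_nearest => //; exists a.
have [Acx0 x0min] := x0n.
have x00 : x0 != 0 by apply/eqP => x0E; apply: Ac0; rewrite -x0E.
have Nx0 : 0 < dot x0 x0 := dot_gt0 dot x00.
(* The divisor is the norm of [x0], positive because 0 lies outside [Ac]. *)
rewrite /rho_min /dA (set_min_dnorm x0n) ltr_pdivrMr ?sqrtr_gt0// => b_lt.
have {}b_lt : dot b b < rho ^+ 2 * dot x0 x0.
  rewrite -(sqr_sqrtr (dot_ge0 dot b)) -[in ltRHS](sqr_sqrtr (ltW Nx0)) -exprMn.
  by rewrite ltrXn2r ?nnegrE ?sqrtr_ge0 ?mulr_ge0 ?sqrtr_ge0 ?ltW.
pose T := conv_hull ([set 0] `|` dilate rho Ac).
have cT : @convex_set R E T by exact: convex_conv_hull.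
have TE : T = [set q | exists s x, [/\ 0 <= s <= rho, Ac x & q = s *: x]].
  by apply: conv_hull0_dilate => //; [exact: ltW|exists a].
have [p pn] : nearest dot T b !=set0.
  apply: compact_image_nearest; last by exists 0; apply: sub_gen_smallest; left.
  (* The truncated cone is the join of 0 with the dilated hull, hence a compact image. *)
  rewrite /T conv_hull_setU1; last by exists (rho *: a), a.
  apply: compact_image_join; rewrite /conv_hull smallest_id.
    exact: compact_image_dilate.
  exact: convex_dilate.
have [s [x [/andP[s0 s_le] Acx pE]]] :
    exists s x, [/\ 0 <= s <= rho, Ac x & p = s *: x].
  by have [Tp _] := pn; move: Tp; rewrite TE.
have Np : dot p p <= dot b b.
  apply: nearest_le pn => q t /andP[t0 t1].
  rewrite TE => -[r [y [/andP[r0 r_le] Acy ->]]].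
  exists (t * r), y; split => //; last by rewrite scalerA.
  by apply/andP; split; nra.
have s_lt : s < rho.
  rewrite lt_neqAle s_le andbT; apply/eqP => sE; subst s.
  (* If [s = rho], then [dot p p] is at least [rho ^+ 2 * dot x0 x0], which exceeds [dot b b],
     against [Np]. *)
  have := x0min _ Acx; rewrite !subr0 => x0x.
  move: Np; rewrite pE !dotE leNgt => /negP; apply.
  rewrite (lt_le_trans b_lt)// mulrA -expr2 ler_wpM2l// sqr_ge0//.
have pnK : nearest dot (gen_cone A) b p.
  by rewrite pE; apply: (nearest_gen_cone s0 s_lt) => //; rewrite -pE -TE.
by rewrite /bK /bco (orth_projP (convex_gen_cone (X := A)) pnK) (orth_projP cT pn).
Qed.
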